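(* Let $P_c\in[0,1]$ with $P_c>0.5$. For each integer $n\ge 1$ let $p_{MGR}(spu)$ (which depends on $n$ and $P_c$) be the probability, defined in the context, that the predictor overfits to the spurious correlation when there are $n$ generators. Then for every real number $P_s>0$ there exists a constant $N$ such that $$\forall n>N,\quad p_{MGR}(spu)<P_s .$$
   Context: Setting. Fix real numbers $a>b$. There are $n\ge 1$ generators, and each one selects either a feature subset $X_1$ (the causal rationale) or a feature subset $X_2$ (the spurious one). The number $k$ of generators that select $X_1$ is a random variable with binomial distribution $\mathcal{B}(n,P_c)$; the other $n-k$ generators select $X_2$. The predictor is described by a parameter $\alpha\in[0,1]$, and its expected payoff, given $k$, is $$R_P(\alpha)=k\,\alpha\, a+k(1-\alpha)\, b+(n-k)(1-\alpha)\,a+(n-k)\,\alpha\, b .$$ Definition. The probability that the predictor overfits to the spurious correlation is $$p_{MGR}(spu)=p\left(\frac{\partial R_P(\alpha)}{\partial\alpha}<0\right)=p(k<n-k)=\sum_{0\le k<n/2}\binom{n}{k}P_c^{\,k}(1-P_c)^{n-k}.$$ (For odd $n$ the sum runs over $k=0,\dots,(n-1)/2$; for even $n$ it runs over $k=0,\dots,n/2-1$.) *)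

(* Defs.v *)
From mathcomp Require Import all_boot all_order all_algebra.
From mathcomp Require Import all_classical all_reals all_analysis.
Set Implicit Arguments.
Unset Strict Implicit.
Unset Printing Implicit Defensive.
Import Order.TTheory GRing.Theory Num.Theory.
Import numFieldNormedType.Exports.
Local Open Scope classical_set_scope.
Local Open Scope ring_scope.

(* The difference n - k is taken in R: natural-number subtraction would
   truncate it for k > n. *)
Definition predictor_payoff (R : realType) (a b : R) (n k : nat) (alpha : R) : R :=
  k%:R * alpha * a + k%:R * (1 - alpha) * b
  + (n%:R - k%:R) * (1 - alpha) * a + (n%:R - k%:R) * alpha * b.

(* The number k of generators selecting the causal rationale is the outcome of
   the binomial law on nat.  The payoff is affine in alpha, so the event, and
   hence the probability, does not depend on the alpha at which the derivative
   is taken. *)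
Definition p_MGR_spu (R : realType) (a b : R) (n : nat) (Pc alpha : R) : \bar R :=
  binomial_prob n Pc [set k | ((predictor_payoff a b n k)^`())%classic alpha < 0].

(* Main.v *)
Require Import Defs.
From mathcomp Require Import all_boot all_order all_algebra.
From mathcomp Require Import all_classical all_reals all_analysis.
From mathcomp Require Import ring lra zify.
Import Order.TTheory GRing.Theory Num.Theory.
Import numFieldNormedType.Exports.
Local Open Scope ring_scope.

(* Exponential Markov bound: with weight 1 / (2 p) < 1, each term with 2 k < n
   of the binomial expansion of 1 = (p + (1 - p))^n is at most the matching
   term of the expansion of (1/2 + 2 p (1 - p))^n.  Since 4 p (1 - p) < 1 for
   p <> 1/2, this base is less than 1. *)

Lemma derive1_predictor_payoff (R : realType) (a b : R) (n k : nat) (alpha : R) :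
  ((predictor_payoff a b n k)^`())%classic alpha
  = (k%:R *+ 2 - n%:R) * (a - b).
Proof.
set c : R := (k%:R *+ 2 - n%:R) * (a - b).
(* The payoff is affine in [alpha]; as slope times identity plus a constant, its derivative is found
   by [derive_val]. *)
have -> : predictor_payoff a b n k =
    c \*: (@id R) \+ cst (k%:R * b + (n%:R - k%:R) * a).
  by apply/funext => x; rewrite /predictor_payoff /c /= /GRing.scale /=; ring.
by rewrite derive1E derive_val addr0 [_%:A]mulr1.
Qed.

Lemma predictor_payoff_derive1_lt0 (R : realType) (a b : R) (n k : nat)
    (alpha : R) : b < a ->
  (((predictor_payoff a b n k)^`())%classic alpha < 0) = (k.*2 < n)%N.
Proof.
move=> ba; rewrite derive1_predictor_payoff pmulr_llt0 ?subr_gt0//.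
by rewrite subr_lt0 -mulrnA muln2 ltr_nat.
Qed.

(** Split p as 1/2 * 2p: since 2p >= 1 and k <= n - k, the factor (2p)^k is at most (2p)^(n - k). *)
Lemma binomial_term_le (R : realType) (p : R) (n k : nat) :
  2^-1 <= p <= 1 -> (k.*2 <= n)%N ->
  p ^+ k * (1 - p) ^+ (n - k) <= 2^-1 ^+ k * (2 * p * (1 - p)) ^+ (n - k).
Proof.
move=> /andP[p2 p1] kn; have {1}-> : p = 2^-1 * (2 * p) by field.
rewrite exprMn [X in _ <= _ * X]exprMn -mulrA ler_wpM2l ?exprn_ge0 ?invr_ge0//.
rewrite ler_wpM2r ?exprn_ge0 ?subr_ge0//.
by apply: ler_weXn2l; [lra|lia].
Qed.

Lemma binomial_prob_minority_le (R : realType) (p : R) (n : nat) :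
  2^-1 <= p <= 1 ->
  (binomial_prob n p [set k | (k.*2 < n)%N]
     <= ((2^-1 + 2 * p * (1 - p)) ^+ n)%:E)%E.
Proof.
move=> /andP[p2 p1]; have p0 : 0 <= p by lra.
(* [exprDn] puts the summation index on the second summand, so 1/2 is moved there to receive the
   exponent k. *)
rewrite (@binomial_probE R n p p0 p1) [2^-1 + _]addrC exprDn -sumEFin.
apply: lee_sum => k _; rewrite diracE -EFinM lee_fin /= [leLHS]mulrnAl ler_wMn2r//.
(* The Dirac mass is the indicator of the event: inside, the termwise bound applies; outside, the
   left side is 0. *)
have [/set_mem/= kn|_] := boolP (_ \in _).
  by rewrite mulr1 [leRHS]mulrC binomial_term_le ?p2// ltnW.
by rewrite mulr0 mulr_ge0// exprn_ge0//; nra.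
Qed.

Theorem theorem1 (R : realType) (a b : R) (hab : b < a)
    (Pc : R) (hPc01 : 0 <= Pc <= 1) (hPc : 2^-1 < Pc)
    (Ps : R) (hPs : 0 < Ps) :
  exists N : nat, forall n : nat, (N < n)%N ->
    forall alpha : R, 0 <= alpha <= 1 ->
      (p_MGR_spu a b n Pc alpha < Ps%:E)%E.
Proof.
(* The gap to 1 is (2 Pc - 1)^2 / 2 > 0. *)
have c1 : `|2^-1 + 2 * Pc * (1 - Pc)| < 1 by rewrite ger0_norm; nra.
(* Geometric decay provides N, chosen before [alpha]; the bound holds already from n = N on. *)
have [N _ HN] : (\forall n \near \oo, (2^-1 + 2 * Pc * (1 - Pc)) ^+ n < Ps)%classic.
  exact: (cvgr_lt _ (cvg_expr c1)).
exists N => n Nn alpha _; rewrite /p_MGR_spu.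
under eq_set do rewrite predictor_payoff_derive1_lt0//.
have hPc1 : 2^-1 <= Pc <= 1 by rewrite ltW//; case/andP: hPc01.
apply: le_lt_trans (binomial_prob_minority_le _ _ _ hPc1) _.
by rewrite lte_fin; apply: HN; exact: ltnW.
Qed.
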